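(* Let $R$ be an integral domain, and let $S$ be an infinite subset of $R$. Then $R$ is a finite factorization domain (FFD) if and only if $\mathrm{Int}(S,R)$ is an FFD.
   Context: For an integral domain $R$ with quotient field $K$ and a subset $S$ of $R$, $\mathrm{Int}(S,R) := \{p(x) \in K[x] \mid p(S) \subseteq R\}$ is the ring of integer-valued polynomials of $R$ on $S$, a subring of $K[x]$. An integral domain is atomic if every nonzero nonunit is a finite product of irreducibles. An integral domain is a finite factorization domain (FFD) if it is atomic and every nonzero nonunit has only finitely many factorizations into irreducibles, up to order and associates; equivalently, it is atomic and every nonzero element has only finitely many irreducible divisors up to associates. *)

(* Defs.v *)
From HB Require Import structures.
From mathcomp Require Import all_boot all_order all_algebra.
From mathcomp Require Import boolp classical_sets cardinality.

Set Implicit Arguments.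
Unset Strict Implicit.
Unset Printing Implicit Defensive.

Import GRing.Theory.

Local Open Scope classical_set_scope.
Local Open Scope ring_scope.

Section Factorization.
Variable D : idomainType.

Definition irreducible (a : D) : Prop :=
  [/\ a != 0, a \isn't a GRing.unit
    & forall b c, a = b * c -> b \is a GRing.unit \/ c \is a GRing.unit].

Definition associates (a b : D) : Prop :=
  exists2 u, u \is a GRing.unit & b = u * a.

Definition factorization (x : D) (s : seq D) : Prop :=
  (forall a, a \in s -> irreducible a) /\ x = \prod_(a <- s) a.

Definition same_factorization (s t : seq D) : Prop :=
  exists t', [/\ perm_eq t t', size s = size t'
    & forall i, (i < size s)%N -> associates s`_i t'`_i].

Definition atomic : Prop :=
  forall x : D, x != 0 -> x \isn't a GRing.unit -> exists s, factorization x s.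

Definition FFD : Prop :=
  atomic /\
  forall x : D, x != 0 -> x \isn't a GRing.unit ->
    exists F : seq (seq D), forall s, factorization x s ->
      exists2 t, t \in F & same_factorization s t.

End Factorization.

Arguments atomic : clear implicits.
Arguments FFD : clear implicits.

Section IntegerValued.
Variables (R : idomainType) (S : set R).

Definition int_valued : {pred {poly {fraction R}}} :=
  fun p => `[< forall s, S s -> exists r : R, p.[tofrac s] = tofrac r >].

Lemma int_valued_subring : subring_closed int_valued.
Proof.
split.
- by apply/asboolP => s _; exists 1; rewrite hornerC rmorph1.
- move=> p q /asboolP pS /asboolP qS; apply/asboolP => s Ss.
  have [a pa] := pS s Ss; have [b qb] := qS s Ss.
  by exists (a - b); rewrite hornerD hornerN pa qb rmorphB.
- move=> p q /asboolP pS /asboolP qS; apply/asboolP => s Ss.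
  have [a pa] := pS s Ss; have [b qb] := qS s Ss.
  by exists (a * b); rewrite hornerM pa qb rmorphM.
Qed.

HB.instance Definition _ :=
  GRing.isSubringClosed.Build {poly {fraction R}} int_valued int_valued_subring.

Record Int := MkInt { Int_poly :> {poly {fraction R}};
                      _ : Int_poly \in int_valued }.

HB.instance Definition _ := [isSub for Int_poly].
HB.instance Definition _ := [Choice of Int by <:].
HB.instance Definition _ := [SubChoice_isSubComNzRing of Int by <:].

(* Int is not closed under the inverse of {poly {fraction R}} (a constant may
   have its inverse outside of Int), so its units are defined intrinsically. *)
Definition Int_unit : {pred Int} := fun p => `[< exists q, q * p = 1 >].
Definition Int_inv (p : Int) : Int := xget p [set q | q * p = 1].

Lemma Int_mulVp : {in Int_unit, left_inverse 1 Int_inv *%R}.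
Proof. by move=> p /asboolP pU; exact: (xgetPex p pU). Qed.

Lemma Int_unitPl (p q : Int) : q * p = 1 -> Int_unit p.
Proof. by move=> qp1; apply/asboolP; exists q. Qed.

Lemma Int_inv_out : {in [predC Int_unit], Int_inv =1 id}.
Proof.
move=> p /asboolPn pNU; apply: xgetPN => q qp1.
by apply: pNU; exists q.
Qed.

HB.instance Definition _ :=
  GRing.ComNzRing_hasMulInverse.Build Int Int_mulVp Int_unitPl Int_inv_out.

Lemma Int_mulf_eq0 : GRing.integral_domain_axiom Int.
Proof.
move=> p q /(congr1 val); rewrite rmorphM rmorph0 => /eqP.
by rewrite mulf_eq0 -!(rmorph0 (val : Int -> _)) !(inj_eq val_inj).
Qed.

HB.instance Definition _ := GRing.ComUnitRing_isIntegral.Build Int Int_mulf_eq0.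

End IntegerValued.

(* Main.v *)
Require Import Defs.
From HB Require Import structures.
From mathcomp Require Import all_boot all_algebra.
From mathcomp Require Import classical_sets cardinality.
From mathcomp Require Import boolp finmap.

Set Implicit Arguments.
Unset Strict Implicit.
Unset Printing Implicit Defensive.

Import GRing.Theory.
Local Open Scope ring_scope.

(** The proof replaces FFD by an equivalent property in which units are easier
to follow: every nonzero element has only finitely many divisors up to
associates ([FFD_iff_finitely_many_divisors]).  In that form both directions
compare a ring with another one by evaluation.

Evaluation at a point s of S is a ring morphism from Int(S,R) to R, and it
retracts the embedding of R as constant polynomials.  Divisibility in R embeds
in divisibility in Int(S,R), and evaluation turns associates in Int(S,R) into
associates in R, so finiteness of divisors goes down from Int(S,R) to R
([finitely_many_divisors_retract]).

For the converse, let f be a nonzero element of Int(S,R).  Over the quotient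
field K, the polynomial f has finitely many divisors up to a constant factor
of K ([finitely_many_poly_divisors]), so a divisor g of f in Int(S,R) is c h
with c in K and h in a fixed finite list.  What is left is to bound the constants
c up to units of R.  As S is infinite, f does not vanish at some s in S
([infinite_set_nonroot]); then g(s) = c h(s) divides the nonzero element f(s)
in R, so up to a unit of R it is one of finitely many a, and c is
a / h(s) up to that unit ([Int_finitely_many_divisors]). *)

(** * Divisors and factorizations up to associates *)

Section Divisors.
Variable D : idomainType.
Implicit Types (a b c d e x : D) (s t F : seq D).

Lemma associates_refl a : associates a a.
Proof. by exists 1; rewrite ?unitr1 ?mul1r. Qed.

Lemma associates_sym a b : associates a b -> associates b a.
Proof. by case=> u uU ->; exists u^-1; rewrite ?unitrV ?mulKr. Qed.

Lemma associates_trans b a c : associates a b -> associates b c -> associates a c.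
Proof.
case=> u uU -> [v vU ->].
by exists (v * u); rewrite ?unitrM ?vU ?uU ?mulrA.
Qed.

Lemma associates_mul a b c d :
  associates a b -> associates c d -> associates (a * c) (b * d).
Proof.
case=> u uU -> [v vU ->].
by exists (u * v); rewrite ?unitrM ?vU ?uU // mulrACA.
Qed.

Lemma associates_prod s t : size s = size t ->
  (forall i, (i < size s)%N -> associates s`_i t`_i) ->
  associates (\prod_(a <- s) a) (\prod_(a <- t) a).
Proof.
elim: s t => [|a s IHs] [|b t] //= => [_ _|[est] st].
  by rewrite !big_nil; exact: associates_refl.
rewrite !big_cons; apply: associates_mul (st 0%N isT) _.
by apply: IHs => // i ltis; exact: (st i.+1).
Qed.

Definition divisors_within x F : Prop :=
  forall d e, x = d * e -> exists2 a, a \in F & associates d a.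

Definition finitely_many_divisors : Prop :=
  forall x, x != 0 -> exists F, divisors_within x F.

(** If d e = x with d and e nonunits, a factorization of d followed by one of e
is a factorization of x.  Up to associates it is a permutation of one of the
listed factorizations of x, and d is the product of an initial segment of that
permutation. *)
Lemma FFD_finitely_many_divisors : FFD D -> finitely_many_divisors.
Proof.
case=> atomD facD x x0.
have [xU|xNU] := boolP (x \is a GRing.unit).
  exists [:: 1] => d e xde; exists 1; first exact: mem_head.
  have /andP[dU _] : (d \is a GRing.unit) && (e \is a GRing.unit).
    by rewrite -unitrM -xde.
  by exists d^-1; rewrite ?unitrV ?mulVr.
have [F HF] := facD x x0 xNU.
pose P := [seq \prod_(a <- take n t) a
             | t <- flatten (map (@permutations D) F), n <- iota 0 (size t).+1].
exists [:: 1, x & P] => d e xde.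
have /andP[d0 e0] : (d != 0) && (e != 0) by rewrite -negb_or -mulf_eq0 -xde.
have [dU|dNU] := boolP (d \is a GRing.unit).
  exists 1; first exact: mem_head.
  by exists d^-1; rewrite ?unitrV ?mulVr.
have [eU|eNU] := boolP (e \is a GRing.unit).
  by exists x; [rewrite !inE eqxx orbT | exists e => //; rewrite mulrC].
have [s1 [s1irr ds1]] := atomD d d0 dNU.
have [s2 [s2irr es2]] := atomD e e0 eNU.
have [|t tF [t' [tt' szt' st']]] := HF (s1 ++ s2).
  split; last by rewrite big_cat -ds1 -es2.
  by move=> a; rewrite mem_cat => /orP[/s1irr|/s2irr].
have s1t' : (size s1 <= size t')%N by rewrite -szt' size_cat leq_addr.
exists (\prod_(a <- take (size s1) t') a).
  rewrite !inE; apply/orP; right; apply/orP; right.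
  apply: allpairs_f_dep; last by rewrite mem_iota.
  apply/flattenP; exists (permutations t); first exact: map_f.
  by rewrite mem_permutations perm_sym.
rewrite ds1; apply: associates_prod => [|i lti]; first by rewrite size_takel.
have := st' i; rewrite size_cat (ltn_addr _ lti) nth_take // nth_cat lti.
exact.
Qed.

Lemma divisors_within_gt0 x F : divisors_within x F -> (0 < size F)%N.
Proof. by move=> /(_ x 1 (esym (mulr1 x)))[a]; case: F. Qed.

(** The element b * c is not associate to any divisor of b, because c is not a
unit; its representatives in F can thus be dropped.  This makes the number of
representatives a measure for induction on proper divisors. *)
Lemma divisors_within_proper b c F :
  b * c != 0 -> c \isn't a GRing.unit -> divisors_within (b * c) F ->
  exists2 F', divisors_within b F' & (size F' < size F)%N.
Proof.
move=> bc0 cNU bcF; pose p a := ~~ `[< associates (b * c) a >].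
exists [seq a <- F | p a].
  move=> d e bde; have [a aF da] := bcF d (e * c) ltac:(by rewrite bde mulrA).
  exists a => //; rewrite mem_filter aF andbT; apply/asboolPn => bca.
  have [u uU] := associates_trans da (associates_sym bca).
  have d0 : d != 0 by apply: contra_neq bc0 => d0; rewrite bde d0 !mul0r.
  rewrite bde -mulrA (mulrC u) => /(mulfI d0) ecu.
  by move: uU; rewrite -ecu unitrM (negPf cNU) andbF.
have [a aF bca] := bcF (b * c) 1 (esym (mulr1 _)).
rewrite size_filter ltn_neqAle count_size andbT -all_count.
by apply/allPn; exists a => //; rewrite /p negbK; apply/asboolP.
Qed.

Lemma finitely_many_divisors_atomic : finitely_many_divisors -> atomic D.
Proof.
move=> fmdD x x0; have [F] := fmdD x x0.
have [n] := ubnP (size F); elim: n => // n IHn in F x x0 *.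
move=> /ltnSE leFn xF xNU.
have [xirr|xNirr] := pselect (irreducible x).
  exists [:: x]; split; last by rewrite big_seq1.
  by move=> a; rewrite inE => /eqP ->.
have [b [c [xbc bNU cNU]]] : exists b c,
    [/\ x = b * c, b \isn't a GRing.unit & c \isn't a GRing.unit].
  apply: contrapT => noNU; apply: xNirr; split=> // b c xbc.
  have [|bNU] := boolP (b \is a GRing.unit); first by left.
  have [|cNU] := boolP (c \is a GRing.unit); first by right.
  by case: noNU; exists b, c.
have /andP[b0 c0] : (b != 0) && (c != 0) by rewrite -negb_or -mulf_eq0 -xbc.
have factor d e : x = d * e -> d != 0 -> d \isn't a GRing.unit ->
    e \isn't a GRing.unit -> exists s, factorization d s.
  move=> xde d0 dNU eNU; rewrite xde in x0 xF.
  have [F' dF' ltF'] := divisors_within_proper x0 eNU xF.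
  exact: IHn d0 (leq_trans ltF' leFn) dF' dNU.
have [s [sirr bs]] := factor b c xbc b0 bNU cNU.
have [t [tirr ct]] := factor c b (etrans xbc (mulrC b c)) c0 cNU bNU.
exists (s ++ t); split; last by rewrite big_cat -bs -ct.
by move=> a; rewrite mem_cat => /orP[/sirr|/tirr].
Qed.

Lemma factorization_size_bound F s :
  (forall a, a \in s -> irreducible a) ->
  divisors_within (\prod_(a <- s) a) F -> (size s < size F)%N.
Proof.
elim: s F => [|a s IHs] F sirr; first by move=> /divisors_within_gt0.
have [a0 aNU _] := sirr a (mem_head _ _).
have sirr' b : b \in s -> irreducible b.
  by move=> bs; apply: sirr; rewrite inE bs orbT.
rewrite big_cons mulrC => asF.
have [||F' sF' ltF'] := divisors_within_proper _ _ asF => //.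
  rewrite mulf_neq0 // prodf_seq_neq0; apply/allP => b /sirr'[b0 _ _].
  exact/implyP.
exact: leq_ltn_trans (IHs F' sirr' sF') ltF'.
Qed.

Lemma finitely_many_words n F : exists W : seq (seq D), forall s,
  (size s <= n)%N -> (forall a, a \in s -> exists2 b, b \in F & associates a b) ->
  exists2 t, t \in W &
    size s = size t /\ forall i, (i < size s)%N -> associates s`_i t`_i.
Proof.
elim: n => [|n [W HW]].
  exists [:: [::]] => s; rewrite leqn0 size_eq0 => /eqP-> _.
  by exists [::]; rewrite ?mem_head.
exists ([::] :: [seq b :: t | b <- F, t <- W]) => -[_ _|a s /= les sF].
  by exists [::]; rewrite ?mem_head.
have [b bF ab] := sF a (mem_head _ _).
have [|t tW [szt st]] := HW s les.
  by move=> c cs; apply: sF; rewrite inE cs orbT.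
exists (b :: t); first by rewrite inE; apply/orP; right; exact: allpairs_f.
by split=> [|[|i]] //=; [rewrite szt | exact: st].
Qed.

(** Factors of x are divisors of x, so up to associates a factorization is a
word over a finite alphabet; its length is bounded because its partial products
are pairwise nonassociate divisors of x. *)
Lemma finitely_many_divisors_FFD : finitely_many_divisors -> FFD D.
Proof.
move=> fmdD; split=> [|x x0 xNU]; first exact: finitely_many_divisors_atomic.
have [F xF] := fmdD x x0; have [W HW] := finitely_many_words (size F) F.
exists W => s [sirr xs].
have [||t tW [szt st]] := HW s.
- by apply/ltnW/factorization_size_bound => //; rewrite -xs.
- by move=> a a_s; apply: (xF a (\prod_(b <- rem a s) b)); rewrite xs (big_rem a).
by exists t => //; exists t.
Qed.

Lemma FFD_iff_finitely_many_divisors : FFD D <-> finitely_many_divisors.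
Proof.
split; first exact: FFD_finitely_many_divisors.
exact: finitely_many_divisors_FFD.
Qed.

End Divisors.

Lemma finitely_many_divisors_retract (D E : idomainType)
    (i : {rmorphism D -> E}) (r : {rmorphism E -> D}) : cancel i r ->
  finitely_many_divisors E -> finitely_many_divisors D.
Proof.
move=> iK fmdE x x0.
have [|F ixF] := fmdE (i x).
  by apply: contra_neq x0 => ix0; rewrite -(iK x) ix0 rmorph0.
exists (map r F) => d e xde.
have [a aF [u uU aud]] := ixF (i d) (i e) ltac:(by rewrite xde rmorphM).
exists (r a); first exact: map_f.
by exists (r u); [exact: rmorph_unit | rewrite aud rmorphM iK].
Qed.

(** * Divisors of a polynomial over a field *)

(** By induction on the degree: when f = h g is a proper decomposition, every
divisor d of f is the product of gcd(d, g), which divides g, and of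
d / gcd(d, g), which is coprime to g / gcd(d, g) and hence divides h. *)
Lemma finitely_many_poly_divisors (K : fieldType) (f : {poly K}) : f != 0 ->
  exists F : seq {poly K}, forall d, d %| f -> exists2 e, e \in F & d %= e.
Proof.
have [n] := ubnP (size f); elim: n => // n IHn in f *.
move=> /ltnSE lefn f0.
have [[g [gf g1 gNf]]|irrf] := pselect (exists g : {poly K},
    [/\ g %| f, size g != 1%N & ~~ (g %= f)]); last first.
  exists [:: 1; f] => d df.
  have [/eqP d1|d1] := boolP (size d == 1%N).
    by exists 1; rewrite ?mem_head // -size_poly_eq1 d1.
  exists f; first by rewrite !inE eqxx orbT.
  by apply: contrapT => /negP dNf; apply: irrf; exists d.
pose h := f %/ g.
have fhg : f = h * g by rewrite divpK.
have /andP[h0 g0] : (h != 0) && (g != 0) by rewrite -negb_or -mulf_eq0 -fhg.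
have ltgf : (size g < size f)%N.
  by rewrite ltn_neqAle dvdp_leq // andbT dvdp_size_eqp.
have lthf : (size h < size f)%N.
  rewrite size_divp // ltn_subrL size_poly_gt0 f0 andbT.
  by move: g1 g0; rewrite -size_poly_eq0; case: (size g) => [|[]].
have [Fg HFg] := IHn g (leq_trans ltgf lefn) g0.
have [Fh HFh] := IHn h (leq_trans lthf lefn) h0.
exists [seq a * b | a <- Fh, b <- Fg] => d df.
pose k := gcdp d g.
have k0 : k != 0 by rewrite gcdp_eq0 negb_and g0 orbT.
have dk : d %/ k * k = d by rewrite divpK ?dvdp_gcdl.
have gk : g %/ k * k = g by rewrite divpK ?dvdp_gcdr.
have dkh : d %/ k %| h.
  rewrite -(@Gauss_dvdpl _ _ (g %/ k)); last first.
    by apply: coprimep_div_gcd; rewrite g0 orbT.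
  by rewrite -(dvdp_mul2r _ _ k0) dk -mulrA gk -fhg.
have [b bF kb] := HFg k (dvdp_gcdr _ _).
have [a aF dka] := HFh _ dkh.
exists (a * b); first exact: allpairs_f.
by rewrite -dk; exact: eqp_trans (eqp_mulr _ dka) (eqp_mull _ kb).
Qed.

(** * Integer-valued polynomials *)

Section IntegerValued.
Variables (R : idomainType) (S : set R).
Implicit Types (r : R) (p q : Int S).

Lemma Int_const_subproof r : (tofrac r)%:P \in @int_valued R S.
Proof. by apply/asboolP => s _; exists r; rewrite hornerC. Qed.

Definition Int_const r : Int S := MkInt (Int_const_subproof r).

Lemma Int_const_zmod_morphism : zmod_morphism Int_const.
Proof. by move=> a b; apply/val_inj; rewrite /= !rmorphB. Qed.

Lemma Int_const_monoid_morphism : monoid_morphism Int_const.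
Proof. by split=> [|a b]; apply/val_inj; rewrite /= ?rmorph1 // !rmorphM. Qed.

HB.instance Definition _ :=
  GRing.isZmodMorphism.Build R (Int S) Int_const Int_const_zmod_morphism.
HB.instance Definition _ :=
  GRing.isMonoidMorphism.Build R (Int S) Int_const Int_const_monoid_morphism.

Section Evaluation.
Variables (s : R) (Ss : S s).

Definition Int_eval p : R := projT1 (cid (asboolW (valP p) s Ss)).

Lemma Int_evalE p : tofrac (Int_eval p) = (val p).[tofrac s].
Proof. by rewrite /Int_eval; case: cid. Qed.

Lemma tofrac_inj : injective (@tofrac R).
Proof. by move=> a b /eqP; rewrite tofrac_eq => /eqP. Qed.

Lemma Int_eval_zmod_morphism : zmod_morphism Int_eval.
Proof.
move=> p q; apply: tofrac_inj.
by rewrite tofracB !Int_evalE rmorphB hornerD hornerN.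
Qed.

Lemma Int_eval_monoid_morphism : monoid_morphism Int_eval.
Proof.
split=> [|p q]; apply: tofrac_inj.
  by rewrite Int_evalE tofrac1 rmorph1 hornerC.
by rewrite tofracM !Int_evalE rmorphM hornerM.
Qed.

HB.instance Definition _ :=
  GRing.isZmodMorphism.Build (Int S) R Int_eval Int_eval_zmod_morphism.
HB.instance Definition _ :=
  GRing.isMonoidMorphism.Build (Int S) R Int_eval Int_eval_monoid_morphism.

Lemma Int_constK : cancel Int_const Int_eval.
Proof. by move=> r; apply: tofrac_inj; rewrite Int_evalE hornerC. Qed.

Lemma finitely_many_divisors_of_Int :
  finitely_many_divisors (Int S) -> finitely_many_divisors R.
Proof. exact: finitely_many_divisors_retract Int_constK. Qed.

End Evaluation.

Lemma infinite_set_nonroot (f : {poly {fraction R}}) :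
  infinite_set S -> f != 0 -> exists2 s, S s & f.[tofrac s] != 0.
Proof.
move=> infS f0; apply: contrapT => vanish.
have [B BS leB] := infinite_set_fset (size f) infS.
have := max_poly_roots f0 (rs := map (@tofrac R) (enum_fset B)).
rewrite size_map ltnNge leB (map_inj_uniq tofrac_inj) fset_uniq => noroots.
suff: false by []; apply: noroots => //; apply/allP => _ /mapP[s sB ->].
by apply: contrapT => /negP fs; apply: vanish; exists s => //; exact: BS.
Qed.

Lemma Int_finitely_many_divisors : infinite_set S ->
  finitely_many_divisors R -> finitely_many_divisors (Int S).
Proof.
move=> infS fmdR f f0.
have vf0 : val f != 0 by rewrite -(rmorph0 (val : Int S -> _)) (inj_eq val_inj).
have [s Ss fs0] := infinite_set_nonroot infS vf0.
have evf0 : Int_eval Ss f != 0 by rewrite -tofrac_eq0 Int_evalE.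
have [F HF] := fmdR _ evf0.
have [H HH] := finitely_many_poly_divisors vf0.
(* The polynomials a / h(s) * h need not be integer-valued on S: those that are
   not are discarded. *)
exists (pmap insub [seq (tofrac a / h.[tofrac s]) *: h | a <- F, h <- H]).
move=> g e fge.
have [h hH gh] : exists2 h, h \in H & val g %= h.
  by apply: HH; rewrite fge rmorphM dvdp_mulr.
have [a aF [u uU aug]] := HF _ _ (etrans (congr1 _ fge) (rmorphM _ g e)).
have gs0 : (val g).[tofrac s] != 0.
  by apply: contra_neq fs0; rewrite fge rmorphM hornerM => ->; rewrite mul0r.
exists (Int_const u * g); last first.
  by exists (Int_const u); rewrite ?rmorph_unit.
rewrite mem_pmap_sub; apply/allpairsP; exists (a, h); split=> //=.
have [c gch] : exists c, val g = c *: h by eexists; exact: eqpfP gh.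
move: gs0; rewrite aug tofracM Int_evalE -[Int_poly g]/(val g) gch hornerZ.
rewrite mulf_eq0 negb_or => /andP[_ hs0].
by rewrite mulrA mulfK // mul_polyC scalerA.
Qed.

End IntegerValued.

Theorem theorem4p6 (R : idomainType) (S : set R) (hS : infinite_set S) :
  FFD R <-> FFD (Int S).
Proof.
have [s Ss] := infinite_setN0 hS.
rewrite !FFD_iff_finitely_many_divisors; split.
  exact: Int_finitely_many_divisors.
exact: finitely_many_divisors_of_Int Ss.
Qed.
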